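(* Let $\Omega\subset\mathbb{R}^d$ be bounded, nonempty and open and let $\gamma:\mathbb{R}^d\times\mathbb{R}^d\to[0,\infty)$ be measurable with $\operatorname*{ess\,sup}_{x\in\Omega}\int_\Gamma\gamma(y,x)\,dy<\infty$. Define $w:\Gamma\to(0,\infty]$ by $w(y)=\int_\Omega\gamma(y,x)\,dx$. Then $\{y\in\Gamma:w(y)=\infty\}$ is a null set, $$\operatorname{Tr}:\mathrm{V}(\Omega;\gamma)\to L^2(\Gamma;w),\quad\operatorname{Tr}(v)=v|_\Gamma,$$ is a bounded, linear and surjective operator, and $$\operatorname{Ext}:L^2(\Gamma;w)\to\mathrm{V}(\Omega;\gamma),\quad\operatorname{Ext}(c)=c\,\chi_\Gamma,$$ is a bounded, injective and linear operator. Furthermore, $\operatorname{Tr}(\operatorname{Ext}(c))=c$ for all $c\in L^2(\Gamma;w)$.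
   Context: Measurability is with respect to Lebesgue measure. Let $\Gamma:=\{y\in\mathbb{R}^d\setminus\Omega:\int_\Omega\gamma(y,x)\,dx>0\}$. $\mathrm{V}(\Omega;\gamma)$ is the space of measurable $v:\mathbb{R}^d\to\mathbb{R}$ with $$\|v\|_{\mathrm{V}(\Omega;\gamma)}^2:=\int_\Omega v^2(x)\,dx+\int_\Omega\int_{\mathbb{R}^d}(v(x)-v(y))^2\gamma(y,x)\,dy\,dx<\infty,$$ functions agreeing a.e. on $\Omega\cup\Gamma$ being identified. $L^2(\Gamma;w)$ is the weighted Lebesgue space with norm $\|v\|_{L^2(\Gamma;w)}^2=\int_\Gamma v^2(y)w(y)\,dy$. $c\,\chi_\Gamma$ denotes the extension of $c$ by zero outside $\Gamma$. *)

(* Defs.v *)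
From HB Require Import structures.
From mathcomp Require Import all_boot all_order all_algebra.
From mathcomp Require Import all_classical all_reals all_analysis.
From mathcomp Require Import ess_sup_inf.

Set Implicit Arguments.
Unset Strict Implicit.
Unset Printing Implicit Defensive.
Import Order.TTheory GRing.Theory Num.Theory.
Import numFieldNormedType.Exports.

Local Open Scope classical_set_scope.
Local Open Scope ring_scope.

(* Row vectors with the product (Borel) sigma-algebra, generated by the
   coordinates. *)
Definition borelRn (R : realType) (n : nat) : Type := 'rV[R]_n.

Section borelRn.
Context (R : realType) (n : nat).

HB.instance Definition _ := Pointed.on (borelRn R n).

Definition coordRn (i : 'I_n) (v : borelRn R n) : measurableTypeR R :=
  (v : 'rV[R]_n) ord0 i.

Let borelRn_set0 : g_sigma_preimage coordRn set0.
Proof. exact: sigma_algebra0. Qed.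

Let borelRn_setC A : g_sigma_preimage coordRn A ->
  g_sigma_preimage coordRn (~` A).
Proof. exact: sigma_algebraC. Qed.

Let borelRn_bigcup (F : (set (borelRn R n))^nat) :
  (forall i, g_sigma_preimage coordRn (F i)) ->
  g_sigma_preimage coordRn (\bigcup_i (F i)).
Proof. exact: sigma_algebra_bigcup. Qed.

Fact borelRn_display : measure_display. Proof. exact: default_measure_display. Qed.

HB.instance Definition _ := @isMeasurable.Build borelRn_display
  (borelRn R n) (g_sigma_preimage coordRn)
  borelRn_set0 borelRn_setC borelRn_bigcup.

Lemma measurable_coordRn i : measurable_fun [set: borelRn R n] (coordRn i).
Proof.
move=> _ Y mY; rewrite setTI; apply: sub_sigma_algebra => /=.
rewrite -bigcup_seq/=; exists i => /=; first by rewrite mem_index_enum.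
by exists Y => //; rewrite setTI.
Qed.

Lemma measurable_fun_coordRnP d (T : measurableType d) (f : T -> borelRn R n) :
  (forall i, measurable_fun [set: T] (coordRn i \o f)) ->
  measurable_fun [set: T] f.
Proof.
move=> mf _ A mA; rewrite setTI.
suff : g_sigma_preimage coordRn `<=` [set A | measurable (f @^-1` A)] by exact.
apply: smallest_sub.
  split => [|B mB|F mF] /=.
  - by rewrite preimage_set0.
  - by rewrite setTD preimage_setC; exact: measurableC.
  - by rewrite preimage_bigcup; exact: bigcupT_measurable.
rewrite -bigcup_seq/=; apply: bigcup_sub => i _ _ [B mB <-] /=.
by rewrite setTI -[X in measurable X]setTI -comp_preimage; exact: mf.
Qed.

End borelRn.

Section consRn.
Context (R : realType) (n : nat).

Definition consRn (p : measurableTypeR R * borelRn R n) : borelRn R n.+1 :=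
  row_mx (p.1%:M : 'rV[R]_1) (p.2 : 'rV[R]_n).

Definition unconsRn (v : borelRn R n.+1) : measurableTypeR R * borelRn R n :=
  ((v : 'rV[R]_n.+1) ord0 ord0, rsubmx (v : 'rV[R]_(1 + n))).

Lemma consRn0 p : coordRn ord0 (consRn p) = p.1.
Proof.
have := row_mxEl (p.1%:M : 'rV[R]_1) (p.2 : 'rV[R]_n) ord0 ord0.
rewrite [RHS]mxE eqxx mulr1n => <-; rewrite /coordRn /consRn.
by congr fun_of_matrix; exact/val_inj.
Qed.

Lemma consRnS p i : coordRn (lift ord0 i) (consRn p) = coordRn i p.2.
Proof.
have := row_mxEr (p.1%:M : 'rV[R]_1) (p.2 : 'rV[R]_n) ord0 i.
rewrite /coordRn /consRn => <-.
by congr fun_of_matrix; exact/val_inj.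
Qed.

Lemma consRnK : cancel consRn unconsRn.
Proof.
move=> [a v]; rewrite /unconsRn; congr pair; last exact: row_mxKr.
exact: consRn0.
Qed.

Lemma measurable_consRn :
  measurable_fun [set: measurableTypeR R * borelRn R n] consRn.
Proof.
apply: measurable_fun_coordRnP => i.
have [j ->|->] := unliftP ord0 i.
- rewrite (_ : _ \o _ = coordRn j \o snd); last by apply/funext=> p; exact: consRnS.
  by apply: measurableT_comp => //; exact: measurable_coordRn.
- rewrite (_ : _ \o _ = fst); last by apply/funext=> p; exact: consRn0.
  exact: measurable_fst.
Qed.

Lemma measurable_unconsRn : measurable_fun [set: borelRn R n.+1] unconsRn.
Proof.
apply: measurable_fun_pair => /=; first exact: measurable_coordRn.
apply: measurable_fun_coordRnP => i.
rewrite (_ : _ \o _ = coordRn (lift ord0 i)); first exact: measurable_coordRn.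
apply/funext=> v /=; rewrite /coordRn mxE; congr fun_of_matrix; exact/val_inj.
Qed.

End consRn.

Section lebesgue_step.
Local Open Scope ereal_scope.
Context (R : realType) (n : nat) (m : {sigma_finite_measure set (borelRn R n) -> \bar R}).

Definition lebesgue_step : set (borelRn R n.+1) -> \bar R :=
  pushforward (@lebesgue_measure R \x m) (@consRn R n).

HB.instance Definition _ := Measure.copy lebesgue_step
  (measure_function_pushforward__canonical__measure_function_Measure
     (@lebesgue_measure R \x m) (@measurable_consRn R n)).

Let lebesgue_step_sigma_finite : sigma_finite setT lebesgue_step.
Proof.
have /sigma_finiteP[F [TF ndF Foo]] := sigma_finiteT (@lebesgue_measure R).
have /sigma_finiteP[G [TG ndG Goo]] := sigma_finiteT m.
exists (fun k => @unconsRn R n @^-1` (F k `*` G k)).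
  rewrite -preimage_bigcup [X in _ @^-1` X](_ : _ = setT) ?preimage_setT//.
  apply/seteqP; split => // -[x y] _.
  have [i _ Fx] : (\bigcup_i F i) x by rewrite -TF.
  have [j _ Gy] : (\bigcup_i G i) y by rewrite -TG.
  exists (maxn i j) => //; split.
  - by move: x Fx; exact/subsetPset/ndF/leq_maxl.
  - by move: y Gy; exact/subsetPset/ndG/leq_maxr.
move=> k; have [mF Fk] := Foo k; have [mG Gk] := Goo k; split.
  rewrite -[X in measurable X]setTI; apply: measurable_unconsRn => //.
  exact: measurableX.
rewrite /lebesgue_step /pushforward -comp_preimage.
rewrite (_ : _ \o _ = id); last by apply/funext; exact: consRnK.
rewrite preimage_id product_measure1E//.
by rewrite lte_mul_pinfty// ge0_fin_numE.
Qed.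

HB.instance Definition _ := Measure_isSigmaFinite.Build _ _ _ lebesgue_step
  lebesgue_step_sigma_finite.

End lebesgue_step.

Fixpoint borel_lebesgue (R : realType) (n : nat) :
    {sigma_finite_measure set (borelRn R n) -> \bar R} :=
  match n with
  | 0 => dirac ((0 : 'rV[R]_0) : borelRn R 0)
  | k.+1 => lebesgue_step (borel_lebesgue R k)
  end.

Lemma borel_lebesgue_box (R : realType) (n : nat) (a b : 'rV[R]_n) :
  (forall i, a ord0 i <= b ord0 i) ->
  borel_lebesgue R n [set v : borelRn R n |
      forall i, coordRn i v \in `]a ord0 i, b ord0 i]] =
  (\prod_(i < n) (b ord0 i - a ord0 i))%:E.
Proof.
elim: n a b => [|n IH] a b ab.
  rewrite big_ord0 [LHS]diracE mem_set// => -[].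
  by [].
pose a' : 'rV[R]_n := \row_i a ord0 (lift ord0 i).
pose b' : 'rV[R]_n := \row_i b ord0 (lift ord0 i).
pose B : set (borelRn R n) :=
  [set v | forall i, coordRn i v \in `]a' ord0 i, b' ord0 i]].
have mB : measurable B.
  rewrite (_ : B = \bigcap_(i in [set: 'I_n])
      (coordRn i @^-1` [set` `]a' ord0 i, b' ord0 i]])); last first.
    by apply/seteqP; split => v /= Bv i => [_|]; exact: Bv.
  apply: fin_bigcap_measurable => // i _.
  rewrite -[X in measurable X]setTI.
  have mI : @measurable _ (measurableTypeR R) [set` `]a' ord0 i, b' ord0 i]].
    exact: measurable_itv.
  exact: (measurable_coordRn i measurableT mI).
rewrite [LHS]/= /lebesgue_step /pushforward.
rewrite (_ : _ @^-1` _ = [set` `]a ord0 ord0, b ord0 ord0]] `*` B); last first.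
  apply/seteqP; split => -[x v] /= H.
  - split; first by have := H ord0; rewrite consRn0.
    by move=> i; have := H (lift ord0 i); rewrite consRnS !mxE.
  - move=> i; have [j ->|->] := unliftP ord0 i.
      by have := (proj2 H) j; rewrite consRnS !mxE.
    by rewrite consRn0; exact: (proj1 H).
have mI : @measurable _ (measurableTypeR R)
    [set` `]a ord0 ord0, b ord0 ord0]] by exact: measurable_itv.
rewrite (product_measure1E _ _ mI mB).
rewrite [X in (_ * X)%E]IH; last by move=> i; rewrite !mxE.
have ve : lebesgue_measure ([set` `]a ord0 ord0, b ord0 ord0]] : set R) =
    (b ord0 ord0 - a ord0 ord0)%:E.
  rewrite lebesgue_measure_itv/= lte_fin; case: ltP => //.
  by move=> ba; congr EFin; apply/esym/eqP; rewrite subr_eq0 eq_le ba ab.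
rewrite [X in (X * _)%E]ve.
rewrite big_ord_recl -EFinM; congr (_ * _)%:E.
by apply: eq_bigr => i _; rewrite !mxE.
Qed.

(* Lebesgue-measurable (rather than Borel) sets and functions on R^d: the
   Caratheodory completion of the measure above.  [Rn R n] is ['rV[R]_n] with
   the Lebesgue sigma-algebra, [RnRn R n] is R^n x R^n with that of R^(2n). *)
Notation Rn R n := (caratheodory_type (mu_ext (borel_lebesgue R n))).
Notation RnRn R n :=
  (caratheodory_type (mu_ext (borel_lebesgue R n \x borel_lebesgue R n)%E)).

Definition lebesgueRn (R : realType) (n : nat) :
    {measure set (Rn R n) -> \bar R} :=
  @completed_measure_extension _ _ _ (borel_lebesgue R n).

Definition ess_sup_on d (T : measurableType d) (R : realType)
    (mu : {measure set T -> \bar R}) (D : set T) (f : T -> \bar R) : \bar R :=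
  ereal_inf [set M | \forall x \ae mu, D x -> (f x <= M)%E].

Lemma ess_sup_onT d (T : measurableType d) (R : realType)
    (mu : {measure set T -> \bar R}) (f : T -> \bar R) :
  ess_sup_on mu setT f = ess_sup mu f.
Proof.
congr ereal_inf; apply/seteqP; split => M /=; apply: filterS => x.
- by move=> /(_ I).
- by move=> fM _.
Qed.

(* A normed space of functions up to a.e. equality, given by representatives:
   [fs_mem] selects them, [fs_eq] is the identification, [fs_sqnorm] the
   square of the norm. *)
Record fspace (R : realType) (T : Type) := FSpace {
  fs_mem : set (T -> R) ;
  fs_eq : (T -> R) -> (T -> R) -> Prop ;
  fs_sqnorm : (T -> R) -> \bar R }.

Definition fs_norm (R : realType) T (X : fspace R T) (u : T -> R) : R :=
  Num.sqrt (fine (fs_sqnorm X u)).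

Definition fs_subspace (R : realType) T (X : fspace R T) : Prop :=
  fs_mem X (fun=> 0) /\
  forall (a : R) u v, fs_mem X u -> fs_mem X v ->
    fs_mem X (fun x => a * u x + v x).

Section operators.
Context (R : realType) (S T : Type) (X : fspace R S) (Y : fspace R T).
Implicit Type F : (S -> R) -> (T -> R).

(* [F] induces a map from the classes of [X] to the classes of [Y]. *)
Definition operator F : Prop :=
  (forall u, fs_mem X u -> fs_mem Y (F u)) /\
  (forall u v, fs_mem X u -> fs_mem X v -> fs_eq X u v -> fs_eq Y (F u) (F v)).

Definition linear_operator F : Prop :=
  [/\ fs_subspace X, fs_subspace Y, operator F &
    forall (a : R) u v, fs_mem X u -> fs_mem X v ->
      fs_eq Y (F (fun x => a * u x + v x)) (fun y => a * F u y + F v y)].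

Definition bounded_operator F : Prop :=
  exists C : R, forall u, fs_mem X u -> fs_norm Y (F u) <= C * fs_norm X u.

Definition injective_operator F : Prop :=
  forall u v, fs_mem X u -> fs_mem X v -> fs_eq Y (F u) (F v) -> fs_eq X u v.

Definition surjective_operator F : Prop :=
  forall c, fs_mem Y c -> exists2 u, fs_mem X u & fs_eq Y (F u) c.

End operators.

Section nonlocal.
Local Open Scope ereal_scope.
Context (R : realType) (n : nat).
Implicit Types (Om G : set (Rn R n)) (gamma : Rn R n -> Rn R n -> R).
Local Notation leb := (lebesgueRn R n).

(* For [gamma] measurable on R^n x R^n the section [gamma y] is measurable for
   almost every [y] only; elsewhere the integral is the supremum over the simple
   functions below, which affects [Gamma] by a null set. *)
Definition weight Om gamma (y : Rn R n) : \bar R :=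
  \int[leb]_(x in Om) (gamma y x)%:E.

Definition Gamma Om gamma : set (Rn R n) :=
  [set y | ~ Om y /\ 0 < weight Om gamma y].

Definition V_sqnorm Om gamma (v : Rn R n -> R) : \bar R :=
  \int[leb]_(x in Om) (v x ^+ 2)%:E +
  \int[leb]_(x in Om) \int[leb]_y ((v x - v y) ^+ 2 * gamma y x)%:E.

Definition V Om gamma : fspace R (Rn R n) := {|
  fs_mem := [set v | measurable_fun [set: Rn R n] (v : _ -> measurableTypeR R)
                     /\ V_sqnorm Om gamma v < +oo] ;
  fs_eq := fun u v =>
    \forall x \ae leb, (Om `|` Gamma Om gamma) x -> u x = v x ;
  fs_sqnorm := V_sqnorm Om gamma |}.

Definition Ext G (c : G -> R) : Rn R n -> R := valL_ 0%R c.

Definition Tr G (v : Rn R n -> R) : G -> R := sigL G v.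

Definition L2_sqnorm G (w : Rn R n -> \bar R) (c : G -> R) : \bar R :=
  \int[leb]_(y in G) ((Ext c y ^+ 2)%:E * w y).

(* Functions on [G] are integrated and compared through their extension by
   zero, whose values outside [G] are not used. *)
Definition L2 G (w : Rn R n -> \bar R) : fspace R G := {|
  fs_mem := [set c | measurable_fun G (Ext c : _ -> measurableTypeR R)
                     /\ L2_sqnorm w c < +oo] ;
  fs_eq := fun b c => \forall y \ae leb, G y -> Ext b y = Ext c y ;
  fs_sqnorm := L2_sqnorm w |}.

End nonlocal.

(* Main.v *)
Require Import Defs.
From HB Require Import structures.
From mathcomp Require Import all_boot all_order all_algebra.
From mathcomp Require Import all_classical all_reals all_analysis.
From mathcomp Require Import measurable_realfun ring lra.
Import Order.TTheory GRing.Theory Num.Theory.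
Import numFieldNormedType.Exports.

Set Implicit Arguments.
Unset Strict Implicit.
Unset Printing Implicit Defensive.

Local Open Scope classical_set_scope.
Local Open Scope ring_scope.

(* The measure gamma(y, x) dy dx restricted to Gamma x Omega has marginals w(y) dy
   and (int_Gamma gamma(y, x) dy) dx, and the second has density at most M on
   Omega.  Tonelli exchanges the two: int_Gamma w <= M |Omega|, so w is finite
   a.e., and integrating v(y)^2 <= 2 (v(x) - v(y))^2 + 2 v(x)^2 against
   gamma(y, x) bounds the trace by 2 (1 + M) times the square of the V-norm.
   Since c chi_Gamma vanishes on Omega, Ext is even an isometry onto its image.

   Tonelli is needed for the Lebesgue sigma-algebra of R^(2d), which is larger
   than the product of those of R^d; it follows from the Borel case because a
   measurable function agrees with a Borel one off a null set, almost all of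
   whose sections are null. *)

(** * Completion of a measure: approximation by sets of the original sigma-algebra *)

Section completion.
Local Open Scope ereal_scope.
Context d (T : measurableType d) (R : realType).
Variable mu : {measure set T -> \bar R}.
Local Notation cT := (caratheodory_type (mu_ext mu)).
Local Notation cmu := (@completed_measure_extension _ _ _ mu).

(** The outer measure is an infimum over countable covers. The union of a cover within 1/(n+1) of it
    is measurable, and the intersection of these unions over n attains it. Finiteness of the outer
    measure makes the infimum approachable in this way. *)
Lemma mu_ext_outer_approx (A : set T) : mu_ext mu A < +oo ->
  exists F, [/\ measurable F, A `<=` F & mu F = mu_ext mu A].
Proof.
move=> Aoo.
have Afin : mu_ext mu A \is a fin_num.
  by rewrite ge0_fin_numE//; exact: mu_ext_ge0.
have /choice[F HF] : forall n : nat, exists E : set T,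
    [/\ measurable E, A `<=` E & mu E <= mu_ext mu A + n.+1%:R^-1%:E].
  move=> n; have n0 : (0 < n.+1%:R^-1 :> R)%R by rewrite invr_gt0.
  have [_ [C [mC AC] <-] /ltW Cn] := lb_ereal_inf_adherent n0 Afin.
  exists (\bigcup_k C k); split => //; first exact: bigcupT_measurable.
  apply: le_trans Cn; apply: measure_sigma_subadditive => //.
  exact: bigcupT_measurable.
have mF : measurable (\bigcap_n F n).
  by apply: bigcapT_measurable => n; have [] := HF n.
have AF : A `<=` \bigcap_n F n by move=> x Ax n _; have [_ + _] := HF n; exact.
exists (\bigcap_n F n); split => //.
apply/eqP; rewrite eq_le; apply/andP; split; last first.
  by rewrite -(measurable_mu_extE mu mF); exact: le_mu_ext.
apply/lee_addgt0Pr => /= _/posnumP[e]; near \oo => n.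
have [mFn _ Fn] := HF n.
apply: (@le_trans _ _ (mu (F n))).
  by apply: le_measure; rewrite ?inE//; exact: bigcap_inf.
rewrite (le_trans Fn)// leeD2l// lee_fin ltW//.
by near: n; exact: near_infty_natSinv_lt.
Unshelve. all: by end_near. Qed.

Lemma mu_ext0_negligible (A : set cT) :
  mu_ext mu A = 0 -> mu.-negligible A.
Proof.
move=> A0; have [|F [mF AF F0]] := @mu_ext_outer_approx A; first by rewrite A0.
by exists F; split => //; rewrite F0.
Qed.

(** On each piece of finite measure an outer approximation [F] exceeds the set by a null part only.
    Deleting from [F] a measurable null set that covers this part leaves an inner approximation.
    Sigma-finiteness glues the pieces. *)
Lemma cara_inner_approx (A : set cT) : sigma_finite setT mu -> measurable A ->
  exists B : set T, [/\ measurable B, B `<=` A & mu.-negligible (A `\` B)].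
Proof.
move=> [S TS Soo] mA.
have mS k : measurable (S k : set cT).
  by apply: caratheodory_measurable_mu_ext; have [] := Soo k.
have /choice[B HB] : forall k, exists B : set T,
    [/\ measurable B, B `<=` A & mu.-negligible (A `&` S k `\` B)].
  move=> k; pose Ak : set cT := A `&` S k.
  have mAk : measurable Ak by exact: measurableI.
  have Akoo : mu_ext mu Ak < +oo.
    apply: (@le_lt_trans _ _ (mu_ext mu (S k))).
      by apply: le_mu_ext; exact: subIsetr.
    by rewrite measurable_mu_extE; have [] := Soo k.
  have [F [mF AF muF]] := mu_ext_outer_approx Akoo.
  (* Both sets are Caratheodory measurable with the same finite measure, so the completed measure of
     their difference is obtained by subtraction. *)
  have F0 : mu_ext mu (F `\` Ak) = 0.
    have mFc : measurable (F : set cT) by exact: caratheodory_measurable_mu_ext.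
    have cF : mu_ext mu F = mu_ext mu Ak.
      by rewrite -muF -(measurable_mu_extE mu mF).
    have cD : mu_ext mu F < +oo ->
        mu_ext mu (F `\` Ak) = mu_ext mu F - mu_ext mu (F `&` Ak).
      exact: (@measureD _ _ _ cmu _ _ mFc mAk).
    rewrite cD cF// setIidr// subee// ge0_fin_numE//; exact: mu_ext_ge0.
  have [N [mN N0 FN]] := mu_ext0_negligible F0.
  exists (F `\` N); split.
  - exact: measurableD.
  - move=> x [Fx Nx]; apply: contrapT => Ax; apply: Nx; apply: FN; split => //.
    by move=> [].
  - exists N; split => // x [Akx Fx]; apply: contrapT => Nx; apply: Fx.
    by split => //; exact: AF.
exists (\bigcup_k B k); split.
- by apply: bigcupT_measurable => k; have [] := HB k.
- by move=> x [k _ Bx]; have [_ + _] := HB k; exact.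
- have N0 k : mu.-negligible (A `&` S k `\` B k) by have [] := HB k.
  apply: negligibleS (negligible_bigcup N0) => x [Ax Bx].
  have [k _ Skx] : (\bigcup_k S k) x by rewrite -TS.
  by exists k => //; split => // Bkx; apply: Bx; exists k.
Qed.

Lemma negligible_cara (A : set T) : mu.-negligible A -> cmu.-negligible A.
Proof.
move=> [N [mN N0 AN]]; exists N; split => //.
  exact: caratheodory_measurable_mu_ext.
by rewrite /completed_measure_extension measurable_mu_extE.
Qed.

Lemma negligible_cara_measurable (A : set T) :
  mu.-negligible A -> measurable (A : set cT).
Proof. by move=> /negligible_cara; exact: measure_is_complete_caratheodory. Qed.

(** With the identity seen as a measurable map out of the completion, measurability is carried over
    by composition and integrals by pushforward. *)
Lemma measurable_fun_cara_id : measurable_fun setT (fun x : cT => x : T).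
Proof.
by move=> _ A mA; rewrite setTI; exact: caratheodory_measurable_mu_ext.
Qed.

Lemma measurable_fun_cara d' (T' : measurableType d') (f : T -> T') :
  measurable_fun setT f -> measurable_fun [set: cT] f.
Proof. by move=> mf; exact: (measurableT_comp mf measurable_fun_cara_id). Qed.

(** The pushforward of the completed measure along the identity agrees with [mu] on the original
    sigma-algebra. *)
Lemma ge0_integral_cara (f : T -> \bar R) :
  measurable_fun setT f -> (forall x, 0 <= f x) ->
  \int[cmu]_x f x = \int[mu]_x f x.
Proof.
move=> mf f0.
have := @ge0_integral_pushforward _ _ _ _ _ _ measurable_fun_cara_id cmu setT f
  measurableT mf (fun y _ => f0 y).
rewrite preimage_setT /= => <-.
apply: eq_measure_integral; first exact: measurable_fun_cara_id.
by move=> id_meas A mA _; exact: (measurable_mu_extE mu mA).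
Qed.

(* The witness is the supremum over rationals [q >= 0] of [q] times the indicator
   of a Borel subset of [f > q] of full measure. *)
Lemma cara_borel_version (f : cT -> \bar R) : sigma_finite setT mu ->
  measurable_fun setT f -> (forall x, 0 <= f x) ->
  exists h : T -> \bar R, [/\ measurable_fun setT h, (forall x, 0 <= h x) &
    mu.-negligible [set x | h x <> f x]].
Proof.
move=> sf mf f0.
(* An enumeration of the nonnegative rationals; a code that names no rational yields 0. *)
pose q n : R := `|ratr (odflt 0%R (@unpickle rat n))|%R.
have q0 n : (0 <= q n)%R by rewrite /q.
have /choice[B HB] : forall n, exists B : set T, [/\ measurable B,
    B `<=` f @^-1` `](q n)%:E, +oo[ &
    mu.-negligible (f @^-1` `](q n)%:E, +oo[ `\` B)].
  move=> n; apply: cara_inner_approx => //; rewrite -[X in measurable X]setTI.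
  by apply: mf => //; exact: emeasurable_itv.
pose h x := esups (fun n => (q n * \1_(B n) x)%:E) 0%N.
have hE x n : (q n * \1_(B n) x)%:E <= h x.
  by apply: ereal_sup_ubound; exists n.
have h0 x : 0 <= h x.
  by apply: le_trans (hE x 0%N); rewrite lee_fin mulr_ge0.
exists h; split => //.
  apply: measurable_fun_esups => n; apply/measurable_EFinP.
  apply: measurable_funM; first exact: measurable_cst.
  by apply: measurable_indic; have [] := HB n.
have NB n : mu.-negligible (f @^-1` `](q n)%:E, +oo[ `\` B n).
  by have [] := HB n.
(* At a point outside all these exceptional sets, [f x] exceeds [q n] only if [x] lies in [B n]. *)
apply: negligibleS (negligible_bigcup NB) => x /= hf.
apply: contrapT => Nx.
have fB n : (q n)%:E < f x -> B n x.
  move=> qf; apply: contrapT => Bx; apply: Nx; exists n => //; split => //=.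
  by rewrite in_itv/= andbT.
apply: hf; apply/eqP; rewrite eq_le; apply/andP; split.
  apply: ge_ereal_sup => _ [n _ <-]; rewrite indicE.
  have [Bx|Bx] := boolP (x \in B n); last by rewrite mulr0.
  rewrite mulr1; have [_ /(_ x) + _] := HB n; rewrite inE in Bx => /(_ Bx)/=.
  by rewrite in_itv/= andbT => /ltW.
rewrite leNgt; apply/negP => hf.
(* A rational strictly between [h x] and [f x] is one of the [q n], because [h x] is nonnegative.
   Then [x] lies in [B n], so the supremum [h x] is at least [q n], a contradiction. *)
have [r [hr rf]] : exists r : rat, h x < (ratr r)%:E /\ (ratr r)%:E < f x.
  case: (h x) (h0 x) hf => [a _|_|//]; last by rewrite ltNge leey.
  case: (f x) => [b| |//].
    rewrite lte_fin => /rat_in_itvoo[r] /[!in_itv]/= /andP[ar rb].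
    by exists r; rewrite !lte_fin.
  move=> _; have /rat_in_itvoo[r] : (a < a + 1)%R by rewrite ltrDl.
  by rewrite in_itv/= => /andP[ar _]; exists r; rewrite lte_fin ltry.
have qr : q (pickle r) = ratr r.
  by rewrite /q pickleK/= ger0_norm// -lee_fin (le_trans (h0 x))// ltW.
have := hE x (pickle r); rewrite indicE mem_set; last by apply: fB; rewrite qr.
by rewrite mulr1 qr leNgt hr.
Qed.

(** The converse passage, from a version [h] back to [f]: completeness makes [f] measurable as soon
    as it agrees almost everywhere with a measurable function. *)
Lemma ae_eq_ge0_integral_cara (f : cT -> \bar R) (h : T -> \bar R) :
  measurable_fun setT h -> (forall x, 0 <= h x) -> (forall x, 0 <= f x) ->
  mu.-negligible [set x | h x <> f x] ->
  measurable_fun setT f /\ \int[cmu]_x f x = \int[mu]_x h x.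
Proof.
move=> mh h0 f0 /negligible_cara hf.
have fh : ae_eq cmu setT h f.
  by apply: negligibleS hf => x /= /not_implyP[].
have mhc : measurable_fun [set: cT] h by exact: measurable_fun_cara.
have mf : measurable_fun setT f.
  by apply: ae_measurable_fun fh mhc; exact: measure_is_complete_caratheodory.
split => //; rewrite -ge0_integral_cara//.
by apply: ge0_ae_eq_integral => //; exact: ae_eq_sym.
Qed.

End completion.

(** * Tonelli's theorem for the completed product measure *)

Section completed_product.
Local Open Scope ereal_scope.
Context d1 d2 (T1 : measurableType d1) (T2 : measurableType d2) (R : realType).
Variable m1 : {sigma_finite_measure set T1 -> \bar R}.
Variable m2 : {sigma_finite_measure set T2 -> \bar R}.
Local Notation cT1 := (caratheodory_type (mu_ext m1)).
Local Notation cT2 := (caratheodory_type (mu_ext m2)).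
Local Notation cT12 := (caratheodory_type (mu_ext (m1 \x m2))).
Local Notation cm1 := (@completed_measure_extension _ _ _ m1).
Local Notation cm2 := (@completed_measure_extension _ _ _ m2).
Local Notation cm12 := (@completed_measure_extension _ _ _ (m1 \x m2)).

Lemma sigma_finite_product_measure : sigma_finite setT (m1 \x m2).
Proof.
have /sigma_finiteP[F [TF ndF Foo]] := sigma_finiteT m1.
have /sigma_finiteP[G [TG ndG Goo]] := sigma_finiteT m2.
exists (fun k => F k `*` G k) => [|k].
  apply/seteqP; split => // -[x y] _.
  have [i _ Fx] : (\bigcup_i F i) x by rewrite -TF.
  have [j _ Gy] : (\bigcup_i G i) y by rewrite -TG.
  (* Both exhaustions increase, so the larger index serves both coordinates. *)
  exists (maxn i j) => //; split.
  - by move: x Fx; exact/subsetPset/ndF/leq_maxl.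
  - by move: y Gy; exact/subsetPset/ndG/leq_maxr.
have [mF Fk] := Foo k; have [mG Gk] := Goo k; split; first exact: measurableX.
by rewrite product_measure1E// lte_mul_pinfty// ge0_fin_numE.
Qed.

(** The product measure of a measurable null cover is the integral of the measures of its sections;
    an integral of a nonnegative function that is zero forces these to vanish almost everywhere. *)
Lemma negligible_xsection (N : set (T1 * T2)) : (m1 \x m2).-negligible N ->
  m1.-negligible [set x | ~ m2.-negligible (xsection N x)].
Proof.
move=> [M [mM M0 NM]].
have mxM : measurable_fun setT (m2 \o xsection M).
  exact: measurable_fun_xsection.
have : \int[m1]_x `|(m2 \o xsection M) x| = 0.
  by rewrite -[RHS]M0; apply: eq_integral => x _; rewrite gee0_abs.
move=> /(ae_eq_integral_abs m1 measurableT mxM); apply: negligibleS => x /=.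
apply: contra_not => /(_ I) Mx; exists (xsection M x); split => //.
  exact: measurable_xsection.
exact: le_xsection.
Qed.

Lemma negligible_ysection (N : set (T1 * T2)) : (m1 \x m2).-negligible N ->
  m2.-negligible [set y | ~ m1.-negligible (ysection N y)].
Proof.
move=> [M [mM M0 NM]].
have myM : measurable_fun setT (m1 \o ysection M).
  exact: measurable_fun_ysection.
(* The product measure is built from sections in the first variable; uniqueness on rectangles
   identifies it with the one built in the other order. *)
have M0' : (m1 \x^ m2) M = 0.
  rewrite -[RHS]M0; apply: esym; apply: product_measure_unique => //.
  by move=> A B mA mB; exact: product_measure2E.
have : \int[m2]_y `|(m1 \o ysection M) y| = 0.
  by rewrite -[RHS]M0'; apply: eq_integral => y _; rewrite gee0_abs.
move=> /(ae_eq_integral_abs m2 measurableT myM); apply: negligibleS => y /=.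
apply: contra_not => /(_ I) My; exists (ysection M y); split => //.
  exact: measurable_ysection.
exact: le_ysection.
Qed.

(** Tonelli holds for a version [h] on the product sigma-algebra, and the transfer from [h] to [f]
    is made three times: for almost every section, for the inner integral as a function of [x], and
    for the double integral. *)
Lemma cara_tonelli1 (f : cT12 -> \bar R) :
  measurable_fun setT f -> (forall z, 0 <= f z) ->
  [/\ \forall x \ae cm1, measurable_fun [set: cT2] (fun y => f (x, y)),
      measurable_fun [set: cT1] (fun x => \int[cm2]_y f (x, y)) &
      \int[cm12]_z f z = \int[cm1]_x \int[cm2]_y f (x, y)].
Proof.
move=> mf f0.
have [h [mh h0 hf]] := cara_borel_version sigma_finite_product_measure mf f0.
have xhf : m1.-negligible
    [set x | ~ m2.-negligible [set y | h (x, y) <> f (x, y)]].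
  apply: negligibleS (negligible_xsection hf) => x /=; apply: contra_not.
  by apply: negligibleS => y /= hfy; rewrite /xsection/= inE.
have mhx x : measurable_fun setT (fun y => h (x, y)).
  exact: measurableT_comp.
have sec x : m2.-negligible [set y | h (x, y) <> f (x, y)] ->
    measurable_fun [set: cT2] (fun y => f (x, y)) /\
    \int[cm2]_y f (x, y) = \int[m2]_y h (x, y).
  by move=> hfx; apply: ae_eq_ge0_integral_cara.
(* The inner integrals of [f] and [h] agree for almost every [x] only; on the exceptional null set
   that of [f] is arbitrary but nonnegative, which completeness tolerates. *)
have [mF F] : measurable_fun [set: cT1] (fun x => \int[cm2]_y f (x, y)) /\
    \int[cm1]_x \int[cm2]_y f (x, y) = \int[m1]_x \int[m2]_y h (x, y).
  apply: ae_eq_ge0_integral_cara.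
  - exact: measurable_fun_fubini_tonelli_F.
  - by move=> x; exact: integral_ge0.
  - by move=> x; exact: integral_ge0.
  - apply: negligibleS xhf => x /=; apply: contra_not => /sec[_].
    by move=> ->.
split => //.
  apply: negligibleS (negligible_cara xhf) => x /=; apply: contra_not.
  by move=> /sec[].
have [_ ->] := ae_eq_ge0_integral_cara mh h0 f0 hf.
by rewrite F fubini_tonelli1.
Qed.

Lemma cara_tonelli2 (f : cT12 -> \bar R) :
  measurable_fun setT f -> (forall z, 0 <= f z) ->
  [/\ \forall y \ae cm2, measurable_fun [set: cT1] (fun x => f (x, y)),
      measurable_fun [set: cT2] (fun y => \int[cm1]_x f (x, y)) &
      \int[cm12]_z f z = \int[cm2]_y \int[cm1]_x f (x, y)].
Proof.
move=> mf f0.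
have [h [mh h0 hf]] := cara_borel_version sigma_finite_product_measure mf f0.
have yhf : m2.-negligible
    [set y | ~ m1.-negligible [set x | h (x, y) <> f (x, y)]].
  apply: negligibleS (negligible_ysection hf) => y /=; apply: contra_not.
  by apply: negligibleS => x /= hfy; rewrite /ysection/= inE.
have mhy y : measurable_fun setT (fun x => h (x, y)).
  exact: measurableT_comp.
have sec y : m1.-negligible [set x | h (x, y) <> f (x, y)] ->
    measurable_fun [set: cT1] (fun x => f (x, y)) /\
    \int[cm1]_x f (x, y) = \int[m1]_x h (x, y).
  by move=> hfy; apply: ae_eq_ge0_integral_cara.
have [mG G] : measurable_fun [set: cT2] (fun y => \int[cm1]_x f (x, y)) /\
    \int[cm2]_y \int[cm1]_x f (x, y) = \int[m2]_y \int[m1]_x h (x, y).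
  apply: ae_eq_ge0_integral_cara.
  - exact: measurable_fun_fubini_tonelli_G.
  - by move=> y; exact: integral_ge0.
  - by move=> y; exact: integral_ge0.
  - apply: negligibleS yhf => y /=; apply: contra_not => /sec[_].
    by move=> ->.
split => //.
  apply: negligibleS (negligible_cara yhf) => y /=; apply: contra_not.
  by move=> /sec[].
have [_ ->] := ae_eq_ge0_integral_cara mh h0 f0 hf.
by rewrite G fubini_tonelli2.
Qed.

(** A set measurable in the completion is a set of the original sigma-algebra plus a part of a null
    set [N]. The cylinder over [N] is null even if the other factor has infinite measure, since 0
    times +oo is 0. *)
Lemma measurable_fst_cara :
  measurable_fun [set: cT12] (fun z : T1 * T2 => z.1 : cT1).
Proof.
move=> _ A mA; rewrite setTI.
have [B [mB BA [N [mN N0 AN]]]] := cara_inner_approx (sigma_finiteT _) mA.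
rewrite -[A](setDUK BA) preimage_setU; apply: measurableU.
  apply: caratheodory_measurable_mu_ext; rewrite -[X in measurable X]setTI.
  exact: measurable_fst.
apply: negligible_cara_measurable; exists (N `*` setT); split.
- exact: measurableX.
- by transitivity (m1 N * m2 setT); [exact: product_measure1E|rewrite N0 mul0e].
- by move=> z /= /AN.
Qed.

Lemma measurable_snd_cara :
  measurable_fun [set: cT12] (fun z : T1 * T2 => z.2 : cT2).
Proof.
move=> _ A mA; rewrite setTI.
have [B [mB BA [N [mN N0 AN]]]] := cara_inner_approx (sigma_finiteT _) mA.
rewrite -[A](setDUK BA) preimage_setU; apply: measurableU.
  apply: caratheodory_measurable_mu_ext; rewrite -[X in measurable X]setTI.
  exact: measurable_snd.
apply: negligible_cara_measurable; exists (setT `*` N); split.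
- exact: measurableX.
- by transitivity (m1 setT * m2 N); [exact: product_measure1E|rewrite N0 mule0].
- by move=> z /= /AN.
Qed.

Lemma measurableX_cara (A : set cT1) (B : set cT2) :
  measurable A -> measurable B -> measurable (A `*` B : set cT12).
Proof.
move=> mA mB; have /(_ measurableT _ mA) := measurable_fst_cara.
have /(_ measurableT _ mB) := measurable_snd_cara.
by rewrite !setTI => ? ?; apply: measurableI.
Qed.

End completed_product.

(** * Tonelli on rectangles, with a weight depending on one variable *)

Section tonelli_setX.
Local Open Scope ereal_scope.
Context d1 d2 (T1 : measurableType d1) (T2 : measurableType d2) (R : realType).
Variable m1 : {sigma_finite_measure set T1 -> \bar R}.
Variable m2 : {sigma_finite_measure set T2 -> \bar R}.
Local Notation cT1 := (caratheodory_type (mu_ext m1)).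
Local Notation cT2 := (caratheodory_type (mu_ext m2)).
Local Notation cT12 := (caratheodory_type (mu_ext (m1 \x m2))).
Local Notation cm1 := (@completed_measure_extension _ _ _ m1).
Local Notation cm2 := (@completed_measure_extension _ _ _ m2).
Local Notation cm12 := (@completed_measure_extension _ _ _ (m1 \x m2)).
Variables (A : set cT1) (B : set cT2) (f : cT12 -> \bar R).
Hypotheses (mA : measurable A) (mB : measurable B).
Hypotheses (mf : measurable_fun setT f) (f0 : forall z, 0 <= f z).

Lemma measurable_fun_cara_tonelli1 :
  measurable_fun [set: cT1] (fun x => \int[cm2]_(y in B) f (x, y)).
Proof.
(* Cutting [f] off outside a strip turns the integral over [B] into one over the whole factor. *)
have mTB : measurable (setT `*` B : set cT12) by exact: measurableX_cara.
have mfB : measurable_fun [set: cT12] (f \_ (setT `*` B)).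
  by apply/(measurable_restrictT _ mTB).1; exact: measurable_funS mf.
have [_ + _] := cara_tonelli1 mfB (fun z => erestrict_ge0 (fun x _ => f0 x) z).
congr (measurable_fun _ _); apply/funext => x; rewrite [RHS]integral_mkcond.
by apply: eq_integral => y _; rewrite !patchE in_setX in_setT.
Qed.

Lemma measurable_fun_cara_tonelli2 :
  measurable_fun [set: cT2] (fun y => \int[cm1]_(x in A) f (x, y)).
Proof.
have mAT : measurable (A `*` setT : set cT12) by exact: measurableX_cara.
have mfA : measurable_fun [set: cT12] (f \_ (A `*` setT)).
  by apply/(measurable_restrictT _ mAT).1; exact: measurable_funS mf.
have [_ + _] := cara_tonelli2 mfA (fun z => erestrict_ge0 (fun x _ => f0 x) z).
congr (measurable_fun _ _); apply/funext => y; rewrite [RHS]integral_mkcond.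
by apply: eq_integral => x _; rewrite !patchE in_setX in_setT andbT.
Qed.

Lemma cara_tonelli_setX1 (g : cT1 -> R) :
  measurable_fun setT g -> (forall x, 0 <= g x)%R ->
  \int[cm12]_(z in A `*` B) ((g z.1)%:E * f z) =
  \int[cm1]_(x in A) ((g x)%:E * \int[cm2]_(y in B) f (x, y)).
Proof.
move=> mg g0.
have mAB : measurable (A `*` B : set cT12) by exact: measurableX_cara.
have mgf : measurable_fun [set: cT12] (fun z => (g z.1)%:E * f z).
  apply: emeasurable_funM; last exact: mf.
  by apply/measurable_EFinP; apply: (measurableT_comp mg); exact: measurable_fst_cara.
have mgfAB : measurable_fun [set: cT12]
    ((fun z => (g z.1)%:E * f z) \_ (A `*` B)).
  by apply/(measurable_restrictT _ mAB).1; exact: measurable_funS mgf.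
have gf0 z : 0 <= (g z.1)%:E * f z by rewrite mule_ge0// lee_fin.
rewrite integral_mkcond [RHS]integral_mkcond.
have [_ mF ->] := cara_tonelli1 mgfAB
  (fun z => erestrict_ge0 (fun x _ => gf0 x) z).
have [secm _ _] := cara_tonelli1 mf f0.
apply: ge0_ae_eq_integral; [exact: measurableT|exact: mF| | | |].
- apply/(measurable_restrictT _ mA).1; apply: emeasurable_funM.
    by apply/measurable_EFinP; exact: measurable_funS mg.
  exact: measurable_funS measurable_fun_cara_tonelli1.
- by move=> x _; apply: integral_ge0 => y _; exact: erestrict_ge0.
- move=> x _; apply: erestrict_ge0 => {}x _; rewrite mule_ge0 ?lee_fin//.
  exact: integral_ge0.
(* The factor [g x] leaves the inner integral where the section of [f] is measurable, hence for
   almost every [x]. *)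
apply: negligibleS secm => x /=; apply: contra_not => mfx _.
rewrite patchE; case: ifPn => xA.
  rewrite -(ge0_integralZl_EFin _ mB (fun y _ => f0 (x, y))
    (measurable_funS measurableT (@subsetT _ B) mfx) (g0 x)).
  rewrite [RHS]integral_mkcond.
  by apply: eq_integral => y _; rewrite !patchE in_setX xA.
by apply: integral0_eq => y _; rewrite patchE in_setX (negbTE xA).
Qed.

Lemma cara_tonelli_setX2 (g : cT2 -> R) :
  measurable_fun setT g -> (forall y, 0 <= g y)%R ->
  \int[cm12]_(z in A `*` B) ((g z.2)%:E * f z) =
  \int[cm2]_(y in B) ((g y)%:E * \int[cm1]_(x in A) f (x, y)).
Proof.
move=> mg g0.
have mAB : measurable (A `*` B : set cT12) by exact: measurableX_cara.
have mgf : measurable_fun [set: cT12] (fun z => (g z.2)%:E * f z).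
  apply: emeasurable_funM; last exact: mf.
  by apply/measurable_EFinP; apply: (measurableT_comp mg); exact: measurable_snd_cara.
have mgfAB : measurable_fun [set: cT12]
    ((fun z => (g z.2)%:E * f z) \_ (A `*` B)).
  by apply/(measurable_restrictT _ mAB).1; exact: measurable_funS mgf.
have gf0 z : 0 <= (g z.2)%:E * f z by rewrite mule_ge0// lee_fin.
rewrite integral_mkcond [RHS]integral_mkcond.
have [_ mF ->] := cara_tonelli2 mgfAB
  (fun z => erestrict_ge0 (fun x _ => gf0 x) z).
have [secm _ _] := cara_tonelli2 mf f0.
apply: ge0_ae_eq_integral; [exact: measurableT|exact: mF| | | |].
- apply/(measurable_restrictT _ mB).1; apply: emeasurable_funM.
    by apply/measurable_EFinP; exact: measurable_funS mg.
  exact: measurable_funS measurable_fun_cara_tonelli2.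
- by move=> y _; apply: integral_ge0 => x _; exact: erestrict_ge0.
- move=> y _; apply: erestrict_ge0 => {}y _; rewrite mule_ge0 ?lee_fin//.
  exact: integral_ge0.
apply: negligibleS secm => y /=; apply: contra_not => mfy _.
rewrite patchE; case: ifPn => yB.
  rewrite -(ge0_integralZl_EFin _ mA (fun x _ => f0 (x, y))
    (measurable_funS measurableT (@subsetT _ A) mfy) (g0 y)).
  rewrite [RHS]integral_mkcond.
  by apply: eq_integral => x _; rewrite !patchE in_setX yB andbT.
by apply: integral0_eq => x _; rewrite patchE in_setX (negbTE yB) andbF.
Qed.

End tonelli_setX.

(** * Finiteness and integral bounds for linear combinations *)

Lemma lte_combination_pinfty (R : realType) (a b : R) (x y : \bar R) :
  0 <= a -> 0 <= b -> (x < +oo)%E -> (y < +oo)%E ->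
  (a%:E * x + b%:E * y < +oo)%E.
Proof. by move=> a0 b0 xoo yoo; rewrite lte_add_pinfty// lte_mul_pinfty. Qed.

(** Pointwise, 2 a^2 u^2 + 2 v^2 - (a u + v)^2 = (a u - v)^2. This serves the closure of both spaces
    under linear combinations and, with a = -1, the trace bound. *)
Lemma ge0_integral_sq_comb d (T : measurableType d) (R : realType)
    (mu : {measure set T -> \bar R}) (D : set T) (a : R) (u v : T -> R)
    (w : T -> \bar R) :
  measurable D -> measurable_fun D u -> measurable_fun D v ->
  measurable_fun D w -> (forall x, 0 <= w x)%E ->
  (\int[mu]_(x in D) (((a * u x + v x) ^+ 2)%:E * w x) <=
   (2 * a ^+ 2)%:E * \int[mu]_(x in D) ((u x ^+ 2)%:E * w x) +
   2%:E * \int[mu]_(x in D) ((v x ^+ 2)%:E * w x))%E.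
Proof.
move=> mD mu_ mv mw w0.
have m2 (h : T -> R) : measurable_fun D h ->
    measurable_fun D (fun x => (h x ^+ 2)%:E * w x)%E.
  move=> mh; apply: emeasurable_funM => //; apply/measurable_EFinP.
  exact: measurable_funX.
have sq0 (h : T -> R) x : (0 <= (h x ^+ 2)%:E * w x)%E.
  by rewrite mule_ge0// lee_fin sqr_ge0.
have a0 : 0 <= 2 * a ^+ 2 by rewrite mulr_ge0// sqr_ge0.
rewrite -!ge0_integralZl_EFin//; [|exact: m2..].
rewrite -ge0_integralD//; last 4 first.
- by move=> x _; rewrite mule_ge0.
- by apply: measurable_funeM; exact: m2.
- by move=> x _; rewrite mule_ge0.
- by apply: measurable_funeM; exact: m2.
apply: ge0_le_integral => //.
- by move=> x _; exact: (sq0 (fun x => a * u x + v x)).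
- by apply: m2; apply: measurable_funD => //; exact: measurable_funM.
- by apply: emeasurable_funD; apply: measurable_funeM; exact: m2.
- move=> x _.
  have u0 : 0 <= 2 * a ^+ 2 * u x ^+ 2 by rewrite mulr_ge0// sqr_ge0.
  have v0 : 0 <= 2 * v x ^+ 2 by rewrite mulr_ge0// sqr_ge0.
  rewrite !muleA -ge0_muleDl//.
  rewrite lee_wpmul2r// lee_fin -subr_ge0.
  rewrite (_ : _ - _ = (a * u x - v x) ^+ 2) ?sqr_ge0//; ring.
Qed.

(** * Open sets are measurable and bounded sets have finite measure *)

Section euclidean.
Context (R : realType) (n : nat).

Lemma measurable_box (I : 'I_n -> interval R) :
  measurable [set v : borelRn R n | forall i, coordRn i v \in I i].
Proof.
rewrite (_ : [set _ | _] = \bigcap_(i in [set: 'I_n])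
    (coordRn i @^-1` [set` I i])); last first.
  by apply/seteqP; split => v /= Bv i => [_|]; exact: Bv.
apply: fin_bigcap_measurable => // i _.
rewrite -[X in measurable X]setTI.
have mI : @measurable _ (measurableTypeR R) [set` I i] by exact: measurable_itv.
exact: (measurable_coordRn i measurableT mI).
Qed.

(** Balls of the sup norm are boxes, so an open set is the countable union of the rational boxes
    that it contains. *)
Lemma open_measurable_borelRn (A : set 'rV[R]_n) :
  open A -> measurable (A : set (borelRn R n)).
Proof.
move=> oA.
pose box (p : 'rV[rat]_n * rat) : set (borelRn R n) := [set v | forall i,
  coordRn i v \in `]ratr (p.1 ord0 i - p.2), ratr (p.1 ord0 i + p.2)[].
have mbox p : measurable (box p) by exact: measurable_box.
(* Codes that name no box inside [A] contribute the empty set. *)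
pose S k : set (borelRn R n) :=
  if unpickle k is Some p then
    if pselect (box p `<=` A) then box p else set0 else set0.
rewrite (_ : A = \bigcup_k S k); last first.
  apply/seteqP; split => [x Ax|x [k _]]; last first.
    by rewrite /S; case: unpickle => // p; case: pselect => // pA /pA.
  have [e /= e0 xeA] : nbhs_ball x A by apply/nbhs_ballP; exact: oA.
  (* The centre of the box is within [r] of [x], so its points are within 2 r < e of [x]. *)
  have /rat_in_itvoo[r] : 0 < e / 2 by rewrite divr_gt0.
  rewrite in_itv/= => /andP[r0 re].
  have /choice[q Hq] : forall i, exists q : rat, `|x ord0 i - ratr q| < ratr r.
    move=> i; have /rat_in_itvoo[q] : x ord0 i - ratr r < x ord0 i.
      by rewrite ltrBlDr ltrDl.
    rewrite in_itv/= => /andP[xq qx]; exists q.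
    by rewrite ger0_norm ?subr_ge0 ?ltW// ltrBlDr -ltrBlDl.
  pose p : 'rV[rat]_n * rat := (\row_i q i, r).
  have pA : box p `<=` A.
    move=> y py; apply: xeA; split => // i j; rewrite /ball/= (ord1 i).
    have := py j; rewrite /coordRn /p/= mxE in_itv/= raddfB raddfD/= => yq.
    have := Hq j; move: yq re; rewrite ltr_norml ltr_distl.
    lra.
  exists (pickle p) => //; rewrite /S pickleK; case: pselect => // _ i.
  rewrite /coordRn /p/= mxE in_itv/= raddfB raddfD/=.
  by have := Hq i; rewrite ltr_distl.
apply: bigcupT_measurable => k; rewrite /S.
case: (unpickle k) => [p|]; last exact: measurable0.
by case: pselect => pA; [exact: mbox|exact: measurable0].
Qed.

Lemma bounded_lebesgueRn (A : set 'rV[R]_n) :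
  bounded_set A -> (lebesgueRn R n A < +oo)%E.
Proof.
move=> [M [_ HM]].
(* [bounded_set] bounds the norm by every number strictly above [M]; this choice is also
   positive. *)
pose m : R := `|M| + 1.
have Mm : M < m by rewrite ltr_pwDr// ler_norm.
(* The intervals are open on the left, hence the left end below -m. *)
pose B : set (borelRn R n) := [set v | forall i, coordRn i v \in
  `](const_mx (- m - 1) : 'rV[R]_n) ord0 i, (const_mx m : 'rV[R]_n) ord0 i]].
have AB : A `<=` B.
  move=> x Ax i; rewrite !mxE in_itv/= -/m.
  have := HM m Mm x Ax; rewrite /= => xm.
  have : `|x ord0 i| <= m.
    apply: le_trans xm; rewrite [leRHS]/Num.norm/= mx_normrE.
    by apply/bigmax_geP; right => /=; exists (ord0, i).
  rewrite /coordRn ler_norml; lra.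
have mB : measurable B by exact: measurable_box.
apply: (@le_lt_trans _ _ (mu_ext (borel_lebesgue R n) B)).
  exact: le_mu_ext.
have -> : mu_ext (borel_lebesgue R n) B = borel_lebesgue R n B.
  exact: measurable_mu_extE.
rewrite borel_lebesgue_box ?ltry// => i.
rewrite !mxE; have := normr_ge0 M; rewrite /m; lra.
Qed.

End euclidean.

(** * The weight, Gamma and the V-norm as an integral over R^(2d) *)

Section trace_space.
Local Open Scope ereal_scope.
Context (R : realType) (d : nat).
Variables (Om : set (Rn R d)) (gamma : Rn R d -> Rn R d -> R).
Hypothesis mOm : measurable Om.
Hypothesis gamma_ge0 : forall y x, (0 <= gamma y x)%R.
Hypothesis gamma_measurable : measurable_fun [set: RnRn R d]
  ((fun z : 'rV[R]_d * 'rV[R]_d => gamma z.1 z.2) :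
    RnRn R d -> measurableTypeR R).

Local Notation leb := (lebesgueRn R d).
Local Notation leb2 := (@completed_measure_extension _ _ _
  (borel_lebesgue R d \x borel_lebesgue R d)).
Local Notation G := (Gamma Om gamma).
Local Notation w := (weight Om gamma).
Local Notation gammaE := (fun z : RnRn R d => (gamma z.1 z.2)%:E).

Let measurable_gammaE : measurable_fun [set: RnRn R d] gammaE.
Proof. exact/measurable_EFinP. Qed.

Let gammaE_ge0 z : 0 <= gammaE z. Proof. by rewrite lee_fin. Qed.

Lemma weight_ge0 y : 0 <= w y.
Proof. by apply: integral_ge0 => x _; rewrite lee_fin. Qed.

Lemma measurable_weight : measurable_fun [set: Rn R d] w.
Proof.
exact: (measurable_fun_cara_tonelli1 mOm measurable_gammaE gammaE_ge0).
Qed.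

Lemma measurable_Gamma : measurable (G : set (Rn R d)).
Proof.
(* The interval is unbounded rather than ended by the point +oo, so it contains the value +oo. *)
rewrite (_ : G = ~` Om `&` (setT `&` w @^-1` `]0, +oo[)); last first.
  by apply/seteqP; split => y /=; rewrite in_itv/= andbT => -[? //]; case.
apply: measurableI; first exact: measurableC.
by apply: measurable_weight => //; exact: emeasurable_itv.
Qed.

(** In [z] the first entry is y and the second x, in the order of the arguments of [gamma].
    Integrating x out first leaves the marginal [w]. *)
Lemma weighted_tonelli1 (A : set (Rn R d)) (g : Rn R d -> measurableTypeR R) :
  measurable A -> measurable_fun [set: Rn R d] g -> (forall y, 0 <= g y)%R ->
  \int[leb2]_(z in A `*` Om) ((g z.1)%:E * gammaE z) =
  \int[leb]_(y in A) ((g y)%:E * w y).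
Proof.
move=> mA mg g0.
exact: (cara_tonelli_setX1 mA mOm measurable_gammaE gammaE_ge0 mg g0).
Qed.

(** Integrating y out first leaves the other marginal, the one controlled by the essential bound
    when [A] is Gamma. *)
Lemma weighted_tonelli2 (A : set (Rn R d)) (g : Rn R d -> measurableTypeR R) :
  measurable A -> measurable_fun [set: Rn R d] g -> (forall y, 0 <= g y)%R ->
  \int[leb2]_(z in A `*` Om) ((g z.2)%:E * gammaE z) =
  \int[leb]_(x in Om) ((g x)%:E * \int[leb]_(y in A) (gamma y x)%:E).
Proof.
move=> mA mg g0.
exact: (cara_tonelli_setX2 mA mOm measurable_gammaE gammaE_ge0 mg g0).
Qed.

Lemma measurable_fun_fst_RnRn (u : Rn R d -> measurableTypeR R) :
  measurable_fun [set: Rn R d] u ->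
  measurable_fun [set: RnRn R d] (fun z => u z.1).
Proof. by move=> mu; apply: (measurableT_comp mu); exact: measurable_fst_cara. Qed.

Lemma measurable_fun_snd_RnRn (u : Rn R d -> measurableTypeR R) :
  measurable_fun [set: Rn R d] u ->
  measurable_fun [set: RnRn R d] (fun z => u z.2).
Proof. by move=> mu; apply: (measurableT_comp mu); exact: measurable_snd_cara. Qed.

(** As a single integral over R^(2d), the nonlocal term can be estimated pointwise in (y, x). *)
Lemma V_sqnormE (u : Rn R d -> measurableTypeR R) :
  measurable_fun [set: Rn R d] u ->
  V_sqnorm Om gamma u = \int[leb]_(x in Om) (u x ^+ 2)%:E +
    \int[leb2]_(z in setT `*` Om) (((u z.2 - u z.1) ^+ 2)%:E * gammaE z).
Proof.
move=> mu; congr (_ + _).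
pose k (z : RnRn R d) := ((u z.2 - u z.1) ^+ 2)%:E * gammaE z.
have mk : measurable_fun [set: RnRn R d] k.
  apply: emeasurable_funM; last exact: measurable_gammaE.
  apply/measurable_EFinP; apply: measurable_funX.
  apply: measurable_funB; first exact: measurable_fun_snd_RnRn.
  exact: measurable_fun_fst_RnRn.
have k0 z : 0 <= k z by rewrite mule_ge0// lee_fin sqr_ge0.
have := @cara_tonelli_setX2 _ _ _ _ _ (borel_lebesgue R d) (borel_lebesgue R d)
  setT Om k measurableT mOm mk k0 (cst 1%R) (measurable_cst _) (fun=> ler01).
under eq_integral do rewrite mul1e.
move=> ->; apply: eq_integral => x _; rewrite mul1e.
by apply: eq_integral => y _; rewrite EFinM.
Qed.

(** * Restriction to Gamma and extension by zero *)

Lemma Ext_restrict (c : G -> R) : (Ext c) \_ G = Ext c.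
Proof. by rewrite -[c in RHS](valLK 0%R) /Ext -sigLK. Qed.

Lemma Ext_out (c : G -> R) y : ~ G y -> Ext c y = 0%R.
Proof. by move=> Gy; rewrite -Ext_restrict patchE memNset. Qed.

Lemma Ext_Tr (u : Rn R d -> R) y : G y -> Ext (@Tr R d G u) y = u y.
Proof.
move=> Gy; have -> : Ext (@Tr R d G u) = u \_ G by rewrite /Ext /Tr -sigLK.
by rewrite patchE mem_set.
Qed.

Lemma Tr_Ext (c : G -> R) : Tr (Ext c) = c.
Proof. exact: valLK. Qed.

Lemma measurable_Ext (c : G -> R) :
  measurable_fun G (Ext c : Rn R d -> measurableTypeR R) ->
  measurable_fun [set: Rn R d] (Ext c : Rn R d -> measurableTypeR R).
Proof.
move=> mc; rewrite -Ext_restrict.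
by apply/(measurable_restrictT _ _).1 => //; exact: measurable_Gamma.
Qed.

(** Gamma is disjoint from Omega, so [Ext c] vanishes on Omega: the local term is zero and the
    squared difference reduces to c(y)^2, which Tonelli pairs with [w]. *)
Lemma V_sqnorm_Ext (c : G -> R) :
  measurable_fun G (Ext c : Rn R d -> measurableTypeR R) ->
  V_sqnorm Om gamma (Ext c) = L2_sqnorm w c.
Proof.
move=> /measurable_Ext mc; rewrite V_sqnormE//.
have c0 x : Om x -> Ext c x = 0%R by move=> Omx; apply: Ext_out => -[].
rewrite integral0_eq ?add0e; last by move=> x /c0 ->; rewrite expr0n.
under eq_integral => z.
  rewrite inE => -[_ /c0 ->]; rewrite sub0r sqrrN; over.
rewrite (weighted_tonelli1 measurableT (measurable_funX 2 mc)
  (fun y => sqr_ge0 (Ext c y))).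
rewrite /L2_sqnorm [RHS]integral_mkcond; apply: eq_integral => y _.
rewrite patchE; case: ifPn => // /negP Gy; rewrite Ext_out ?expr0n/= ?mul0e//.
by move=> /mem_set.
Qed.

(** * Closure of both spaces under linear combinations *)

Lemma V_sqnorm_comb (a : R) (u v : Rn R d -> measurableTypeR R) :
  measurable_fun [set: Rn R d] u -> measurable_fun [set: Rn R d] v ->
  V_sqnorm Om gamma (fun x => a * u x + v x)%R <=
  (2 * a ^+ 2)%:E * V_sqnorm Om gamma u + 2%:E * V_sqnorm Om gamma v.
Proof.
move=> mu mv.
have a0 : (0 <= 2 * a ^+ 2)%R by rewrite mulr_ge0// sqr_ge0.
have mTO : measurable (setT `*` Om : set (RnRn R d)) by exact: measurableX_cara.
have onTO (h : RnRn R d -> measurableTypeR R) :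
    measurable_fun setT h -> measurable_fun (setT `*` Om : set (RnRn R d)) h.
  by move=> mh; exact: (measurable_funS measurableT (@subsetT _ _) mh).
have mdiff (h : Rn R d -> measurableTypeR R) : measurable_fun setT h ->
    measurable_fun [set: RnRn R d] (fun z => h z.2 - h z.1)%R.
  move=> mh; apply: measurable_funB; first exact: measurable_fun_snd_RnRn.
  exact: measurable_fun_fst_RnRn.
have onOm (h : Rn R d -> measurableTypeR R) :
    measurable_fun setT h -> measurable_fun Om h.
  by move=> mh; exact: (measurable_funS measurableT (@subsetT _ _) mh).
have arith (I1 J1 I2 J2 : \bar R) : 0 <= I1 -> 0 <= J1 -> 0 <= I2 -> 0 <= J2 ->
    ((2 * a ^+ 2)%:E * I1 + 2%:E * I2) + ((2 * a ^+ 2)%:E * J1 + 2%:E * J2) =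
    (2 * a ^+ 2)%:E * (I1 + J1) + 2%:E * (I2 + J2).
  by move=> *; rewrite !ge0_muleDr// addeACA.
have mc : measurable_fun [set: Rn R d]
    ((fun x => a * u x + v x)%R : _ -> measurableTypeR R).
  by apply: measurable_funD; [apply: measurable_funM; [exact: measurable_cst|]|].
have sq0 (h : Rn R d -> R) : 0 <= \int[leb]_(x in Om) (h x ^+ 2)%:E.
  by apply: integral_ge0 => x _; rewrite lee_fin sqr_ge0.
have sqg0 (h : RnRn R d -> R) :
    0 <= \int[leb2]_(z in setT `*` Om) ((h z ^+ 2)%:E * gammaE z).
  by apply: integral_ge0 => z _; rewrite mule_ge0// lee_fin sqr_ge0.
(* Both terms are weighted integrals of squares of expressions linear in the function, so the
   quadratic inequality applies to each, with weights 1 and [gamma]. *)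
rewrite !V_sqnormE// -arith//; apply: leeD.
  have sq1 (h : Rn R d -> R) : \int[leb]_(x in Om) (h x ^+ 2)%:E =
      \int[leb]_(x in Om) ((h x ^+ 2)%:E * cst 1 x).
    by apply: eq_integral => x _; rewrite mule1.
  rewrite !sq1; exact: (ge0_integral_sq_comb leb a mOm (onOm _ mu) (onOm _ mv)
    (measurable_cst 1) (fun=> lee01)).
rewrite (eq_integral (fun z : RnRn R d =>
    ((a * (u z.2 - u z.1) + (v z.2 - v z.1)) ^+ 2)%:E * gammaE z)); last first.
  by move=> z _; congr ((_ ^+ 2)%:E * _); ring.
exact: (ge0_integral_sq_comb leb2 a mTO (onTO _ (mdiff _ mu))
  (onTO _ (mdiff _ mv))
  (measurable_funS measurableT (@subsetT _ _) measurable_gammaE) gammaE_ge0).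
Qed.

Lemma Ext_comb (a : R) (b c : G -> R) :
  Ext (fun y => a * b y + c y)%R = (fun x => a * Ext b x + Ext c x)%R.
Proof.
apply/funext => x; rewrite /Ext/=; case: ('oinv_set_val x) => //=.
by rewrite mulr0 addr0.
Qed.

Lemma L2_sqnorm_comb (a : R) (b c : G -> R) :
  measurable_fun G (Ext b : Rn R d -> measurableTypeR R) ->
  measurable_fun G (Ext c : Rn R d -> measurableTypeR R) ->
  L2_sqnorm w (fun y => a * b y + c y)%R <=
  (2 * a ^+ 2)%:E * L2_sqnorm w b + 2%:E * L2_sqnorm w c.
Proof.
move=> mb mc; rewrite /L2_sqnorm Ext_comb.
apply: ge0_integral_sq_comb => //; first exact: measurable_Gamma.
  exact: (measurable_funS measurableT (@subsetT _ _) measurable_weight).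
exact: weight_ge0.
Qed.

Lemma V_subspace : fs_subspace (V Om gamma).
Proof.
split=> [|a u v [mu u_fin] [mv v_fin]] /=; split; first exact: measurable_cst.
- rewrite /V_sqnorm !integral0_eq ?adde0// => x _; rewrite ?expr0n//.
  by rewrite integral0_eq// => y _; rewrite subrr expr0n mul0r.
- by apply: measurable_funD; [apply: measurable_funM; [exact: measurable_cst|]|].
- apply: le_lt_trans (V_sqnorm_comb a mu mv) _.
  have a0 : (0 <= 2 * a ^+ 2)%R by rewrite mulr_ge0// sqr_ge0.
  exact: lte_combination_pinfty.
Qed.

Lemma L2_subspace : fs_subspace (L2 G w).
Proof.
have E0 : Ext ((fun=> 0%R) : G -> R) = fun=> 0%R.
  by apply/funext => x; rewrite /Ext/=; case: ('oinv_set_val x).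
split=> [|a u v [mu u_fin] [mv v_fin]] /=; split.
- by rewrite E0; exact: measurable_cst.
- by rewrite /L2_sqnorm E0 integral0_eq// => y _; rewrite expr0n mul0e.
- rewrite Ext_comb.
  by apply: measurable_funD; [apply: measurable_funM; [exact: measurable_cst|]|].
- apply: le_lt_trans (L2_sqnorm_comb a mu mv) _.
  have a0 : (0 <= 2 * a ^+ 2)%R by rewrite mulr_ge0// sqr_ge0.
  exact: lte_combination_pinfty.
Qed.

(** * Consequences of the essential bound [M] *)

Hypothesis Om_fin : leb Om < +oo.
Variable M : R.
Hypothesis M_ge0 : (0 <= M)%R.
Hypothesis gamma_bound :
  \forall x \ae leb, Om x -> \int[leb]_(y in G) (gamma y x)%:E <= M%:E.

Let measurable_mass :
  measurable_fun [set: Rn R d] (fun x => \int[leb]_(y in G) (gamma y x)%:E).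
Proof.
exact: (measurable_fun_cara_tonelli2 measurable_Gamma measurable_gammaE
  gammaE_ge0).
Qed.

Lemma weighted_gamma_le (g : Rn R d -> measurableTypeR R) :
  measurable_fun [set: Rn R d] g -> (forall y, 0 <= g y)%R ->
  \int[leb2]_(z in G `*` Om) ((g z.2)%:E * gammaE z) <=
  M%:E * \int[leb]_(x in Om) (g x)%:E.
Proof.
move=> mg g0; rewrite weighted_tonelli2//; last exact: measurable_Gamma.
have mgE : measurable_fun Om (EFin \o g).
  by apply/measurable_EFinP; exact: measurable_funS mg.
rewrite -ge0_integralZl_EFin//; last by move=> x _; rewrite lee_fin.
apply: ae_ge0_le_integral.
- exact: mOm.
- move=> x _; rewrite mule_ge0 ?lee_fin//.
  by apply: integral_ge0 => y _; rewrite lee_fin.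
- apply: emeasurable_funM; first exact: mgE.
  exact: (measurable_funS measurableT (@subsetT _ Om) measurable_mass).
- by move=> x _; rewrite mule_ge0 ?lee_fin.
- exact: measurable_funeM.
apply: negligibleS gamma_bound => x /=; apply: contra_not => + Omx.
move=> /(_ Omx) gM.
by rewrite muleC lee_wpmul2r// lee_fin.
Qed.

(** The constant function 1 in [weighted_gamma_le] bounds the integral of [w] over Gamma by [M]
    times the measure of Omega, and an integrable function is finite almost everywhere. *)
Lemma negligible_weight_pinfty : leb.-negligible [set y | G y /\ w y = +oo].
Proof.
have mw : measurable_fun G w by exact: measurable_funS measurable_weight.
have wfin : leb.-integrable G w.
  apply/integrableP; split => //.
  under eq_integral do rewrite gee0_abs ?weight_ge0//.
  have m1 : measurable_fun [set: Rn R d]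
      ((fun=> 1%R) : Rn R d -> measurableTypeR R).
    exact: measurable_cst.
  have -> : \int[leb]_(y in G) w y =
      \int[leb2]_(z in G `*` Om) (1%:E * gammaE z).
    rewrite (weighted_tonelli1 measurable_Gamma m1 (fun=> ler01)).
    by apply: eq_integral => y _; rewrite mul1e.
  apply: le_lt_trans (weighted_gamma_le m1 (fun=> ler01)) _.
  by rewrite integral_cst// mul1e lte_mul_pinfty.
have := integrable_ae measurable_Gamma wfin; apply: negligibleS => y /= [Gy wy].
by move=> /(_ Gy); rewrite wy.
Qed.

Lemma L2_sqnorm_Tr (u : Rn R d -> measurableTypeR R) :
  measurable_fun [set: Rn R d] u ->
  L2_sqnorm w (@Tr R d G u) <= (2 * (1 + M))%:E * V_sqnorm Om gamma u.
Proof.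
move=> mu; rewrite V_sqnormE// /L2_sqnorm.
(* [J] stands for the local and [I] for the nonlocal term of the V-norm, [I'] and [J'] for the
   integrals over Gamma x Omega. The constant dominates both 2 and 2 M. *)
have arith (I' J' I J : \bar R) :
    0 <= I -> 0 <= J -> I' <= I -> J' <= M%:E * J ->
    (2 * (-1) ^+ 2)%:E * I' + 2%:E * J' <= (2 * (1 + M))%:E * (J + I).
  move=> I0 J0 I1 J1; rewrite ge0_muleDr// [leRHS]addeC; apply: leeD.
    apply: (@le_trans _ _ ((2 * (-1) ^+ 2)%:E * I)).
      by rewrite lee_wpmul2l// lee_fin; lra.
    by rewrite lee_wpmul2r// lee_fin sqrrN expr1n; have := M_ge0; lra.
  apply: (@le_trans _ _ (2%:E * (M%:E * J))).
    by rewrite lee_wpmul2l ?lee_fin.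
  by rewrite muleA -EFinM lee_wpmul2r// lee_fin; lra.
rewrite [leLHS](_ : _ =
    \int[leb2]_(z in G `*` Om) ((u z.1 ^+ 2)%:E * gammaE z));
    last first.
  rewrite (weighted_tonelli1 measurable_Gamma (measurable_funX 2 mu)
    (fun y => sqr_ge0 (u y))).
  by apply: eq_integral => y /[!inE] Gy; rewrite Ext_Tr.
have mGO : measurable (G `*` Om : set (RnRn R d)).
  by apply: measurableX_cara => //; exact: measurable_Gamma.
have mTO : measurable (setT `*` Om : set (RnRn R d)).
  by apply: measurableX_cara.
have mu1 := measurable_fun_fst_RnRn mu; have mu2 := measurable_fun_snd_RnRn mu.
have mD : measurable_fun [set: RnRn R d] (fun z => u z.2 - u z.1)%R.
  exact: measurable_funB.
(* The decomposition u(y) = -(u(x) - u(y)) + u(x), which calls for a = -1. *)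
rewrite (eq_integral
    (fun z : RnRn R d => ((-1 * (u z.2 - u z.1) + u z.2) ^+ 2)%:E * gammaE z));
    last first.
  by move=> z _; congr ((_ ^+ 2)%:E * _); ring.
have onGO dU (U : measurableType dU) (h : RnRn R d -> U) :
    measurable_fun setT h -> measurable_fun (G `*` Om : set (RnRn R d)) h.
  by move=> mh; exact: (measurable_funS measurableT (@subsetT _ _) mh).
have /le_trans := @ge0_integral_sq_comb _ (RnRn R d) R leb2 (G `*` Om) (-1)%R
  (fun z => u z.2 - u z.1)%R (fun z => u z.2) gammaE mGO (onGO _ _ _ mD)
  (onGO _ _ _ mu2) (onGO _ _ _ measurable_gammaE) gammaE_ge0.
apply.
have sqD z : 0 <= ((u z.2 - u z.1) ^+ 2)%:E * gammaE z.
  by rewrite mule_ge0// lee_fin sqr_ge0.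
have I1 : \int[leb2]_(z in G `*` Om) (((u z.2 - u z.1) ^+ 2)%:E * gammaE z) <=
    \int[leb2]_(z in setT `*` Om) (((u z.2 - u z.1) ^+ 2)%:E * gammaE z).
  apply: ge0_subset_integral;
    [exact: mGO|exact: mTO| |by move=> z _|by move=> z []].
    apply: emeasurable_funM; last exact: measurable_funS measurable_gammaE.
    apply/measurable_EFinP; apply: measurable_funX.
    exact: measurable_funS mD.
have I2 := weighted_gamma_le (measurable_funX 2 mu) (fun y => sqr_ge0 (u y)).
apply: arith I1 I2; first exact: integral_ge0.
by apply: integral_ge0 => x _; rewrite lee_fin sqr_ge0.
Qed.

End trace_space.

(** * From squared norms to norms, and the assembly of the theorem *)

Lemma le_fs_norm (R : realType) S T (X : fspace R S) (Y : fspace R T)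
    (u : S -> R) (v : T -> R) (C : R) :
  0 <= C -> (0 <= fs_sqnorm X u)%E -> (0 <= fs_sqnorm Y v)%E ->
  (fs_sqnorm X u < +oo)%E -> (fs_sqnorm Y v <= C%:E * fs_sqnorm X u)%E ->
  fs_norm Y v <= Num.sqrt C * fs_norm X u.
Proof.
move=> C0 X0 Y0 Xoo YX; rewrite /fs_norm -sqrtrM// ler_wsqrtr//.
(* [fs_norm] passes through [fine], which sends +oo to 0, so comparing norms requires finite squared
   norms. *)
have Xfin : fs_sqnorm X u \is a fin_num by rewrite ge0_fin_numE.
rewrite -[C]/(fine C%:E) -fineM// fine_le// ?fin_numM//.
by rewrite ge0_fin_numE// (le_lt_trans YX)// lte_mul_pinfty.
Qed.

Theorem theorem5p2 (R : realType) (d : nat)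
    (Om : set 'rV[R]_d) (gamma : 'rV[R]_d -> 'rV[R]_d -> R)
    (Om_bounded : bounded_set Om) (Om_nonempty : Om !=set0) (Om_open : open Om)
    (gamma_ge0 : forall y x, 0 <= gamma y x)
    (gamma_measurable : measurable_fun [set: RnRn R d]
      ((fun z : 'rV[R]_d * 'rV[R]_d => gamma z.1 z.2) :
        RnRn R d -> measurableTypeR R))
    (gamma_bounded :
      (ess_sup_on (lebesgueRn R d) Om
        (fun x => \int[lebesgueRn R d]_(y in Gamma Om gamma) (gamma y x)%:E)
       < +oo)%E) :
  let G := Gamma Om gamma in
  let w := weight Om gamma in
  [/\ (lebesgueRn R d).-negligible [set y | G y /\ w y = +oo%E],
      [/\ bounded_operator (V Om gamma) (L2 G w) (@Tr R d G),
          linear_operator (V Om gamma) (L2 G w) (@Tr R d G) &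
          surjective_operator (V Om gamma) (L2 G w) (@Tr R d G)],
      [/\ bounded_operator (L2 G w) (V Om gamma) (@Ext R d G),
          injective_operator (L2 G w) (V Om gamma) (@Ext R d G) &
          linear_operator (L2 G w) (V Om gamma) (@Ext R d G)] &
      forall c, fs_mem (L2 G w) c -> fs_eq (L2 G w) (Tr (Ext c)) c].
Proof.
move=> G w.
have mOm : measurable (Om : set (Rn R d)).
  apply: caratheodory_measurable_mu_ext; exact: open_measurable_borelRn.
have Om_fin := bounded_lebesgueRn Om_bounded.
(* Some essential bound [m] lies below +oo. Its maximum with 0 is a nonnegative real bound, also
   when [m] is -oo. *)
have [M M0 gammaM] : exists2 M : R, 0 <= M & \forall x \ae lebesgueRn R d,
    Om x -> (\int[lebesgueRn R d]_(y in G) (gamma y x)%:E <= M%:E)%E.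
  have [m gm moo] := ereal_inf_lt gamma_bounded.
  exists (Num.max 0 (fine m)); first by rewrite le_max lexx.
  apply: negligibleS gm => x /=; apply: contra_not => gmx Omx.
  apply: le_trans (gmx Omx) _; case: m moo {gmx} => [r _|//|_];
    last by rewrite leNye.
  by rewrite lee_fin le_max /= lexx orbT.
have mG : measurable (G : set (Rn R d)).
  exact: (measurable_Gamma mOm gamma_ge0 gamma_measurable).
have mExt (c : G -> R) : fs_mem (L2 G w) c ->
    measurable_fun [set: Rn R d] (Ext c : Rn R d -> measurableTypeR R).
  by move=> [mc _]; exact: (measurable_Ext mOm gamma_ge0 gamma_measurable mc).
have VExt (c : G -> R) : fs_mem (L2 G w) c ->
    V_sqnorm Om gamma (Ext c) = L2_sqnorm w c.
  by move=> [mc _]; exact: (V_sqnorm_Ext mOm gamma_ge0 gamma_measurable mc).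
have Ext_mem (c : G -> R) : fs_mem (L2 G w) c -> fs_mem (V Om gamma) (Ext c).
  by move=> c_mem; split; [exact: mExt|rewrite VExt//; case: c_mem].
have C0 : 0 <= 2 * (1 + M) by lra.
have L2Tr (u : Rn R d -> R) : fs_mem (V Om gamma) u ->
    (L2_sqnorm w (@Tr R d G u) <= (2 * (1 + M))%:E * V_sqnorm Om gamma u)%E.
  move=> [mu _].
  exact: (L2_sqnorm_Tr mOm gamma_ge0 gamma_measurable M0 gammaM mu).
have V_ge0 (u : Rn R d -> R) : (0 <= V_sqnorm Om gamma u)%E.
  apply: adde_ge0; apply: integral_ge0 => x _; first by rewrite lee_fin sqr_ge0.
  by apply: integral_ge0 => y _; rewrite lee_fin mulr_ge0// sqr_ge0.
have L2_ge0 (c : G -> R) : (0 <= L2_sqnorm w c)%E.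
  apply: integral_ge0 => y _; rewrite mule_ge0 ?lee_fin ?sqr_ge0//.
  exact: weight_ge0.
have Tr_mem (u : Rn R d -> R) :
    fs_mem (V Om gamma) u -> fs_mem (L2 G w) (@Tr R d G u).
  move=> u_mem; split.
    apply: (@eq_measurable_fun _ _ _ _ _ u).
      by move=> y /[!inE] Gy; rewrite Ext_Tr.
    case: u_mem => mu _.
    exact: (measurable_funS measurableT (@subsetT _ _) mu).
  apply: le_lt_trans (L2Tr u u_mem) _; rewrite lte_mul_pinfty ?lee_fin//.
  by case: u_mem.
have VS := V_subspace mOm gamma_ge0 gamma_measurable.
have LS := L2_subspace mOm gamma_ge0 gamma_measurable.
split.
- exact: (negligible_weight_pinfty mOm gamma_ge0 gamma_measurable Om_fin M0
    gammaM).
- split.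
  + exists (Num.sqrt (2 * (1 + M))) => u u_mem.
    apply: (le_fs_norm (X := V Om gamma) (Y := L2 G w) C0 (V_ge0 u) (L2_ge0 _) _
      (L2Tr u u_mem)).
    by case: u_mem.
  + split; [exact: VS|exact: LS|split; first exact: Tr_mem|].
      move=> u v _ _; apply: negligibleS => y /=; apply: contra_not => uv Gy.
      by rewrite !Ext_Tr// uv//; right.
    by move=> a u v _ _; apply: aeW => y Gy; rewrite !Ext_Tr// Ext_comb !Ext_Tr.
  (* Surjectivity comes from the right inverse [Ext]. *)
  + move=> c c_mem; exists (Ext c); first exact: Ext_mem.
    by rewrite Tr_Ext; apply: aeW.
- split.
  (* The squared norms coincide, so the constant is 1, written in the form given by [le_fs_norm]. *)
  + exists (Num.sqrt 1) => c c_mem.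
    apply: (le_fs_norm (X := L2 G w) (Y := V Om gamma) ler01 (L2_ge0 c)
      (V_ge0 _)).
      by case: c_mem.
    by rewrite mul1e /= VExt.
  + by move=> u v _ _; apply: negligibleS => y /=; apply: contra_not => uv Gy;
      apply: uv; right.
  + split; [exact: LS|exact: VS|split; first exact: Ext_mem|].
      (* On Omega both extensions are zero, so only the points of Gamma have to be compared. *)
      move=> u v _ _; apply: negligibleS => x /=.
      apply: contra_not => uv [Omx|/uv//].
      by rewrite !Ext_out// => -[].
    by move=> a u v _ _; apply: aeW => x _; rewrite Ext_comb.
- by move=> c _; rewrite Tr_Ext; apply: aeW.
Qed.
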